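(* Let $n$ be a natural number and let $\mathbf{A}$ be a finite $IG^\star$-chain whose Gödel reduct belongs to the variety generated by the Gödel chain with $n+1$ elements. Then $\mathbf{A}$ is representable if and only if, for all sk-sequences $R=[o_1,\ldots,o_k]$ and for all natural numbers $r\geq 1$ such that $rk\leq n+1$, $\mathbf{A}$ satisfies the equations $$(R1n)\quad {\sim}x\vee x\vee (x\Leftrightarrow_G y)\vee\big[\Delta(f_R(x)\Leftrightarrow_G y)\Rightarrow_G {\sim}\Delta(f_{(r-1)R}(y)\Leftrightarrow_G x)\big]=1$$ and $$(R2n)\quad {\sim}x\vee x\vee{\sim}y\vee y\vee\big[\Delta\big((f_R(x)\Leftrightarrow_G x)\wedge(f_R(y)\Leftrightarrow_G y)\big)\Rightarrow_G\Delta(x\Leftrightarrow_G y)\big]=1.$$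
   Context: A Gödel algebra is a bounded integral commutative residuated lattice $(A,\wedge,\vee,\odot,\Rightarrow_G,0,1)$ with $\odot=\wedge$ satisfying prelinearity $(x\Rightarrow_G y)\vee(y\Rightarrow_G x)=1$; $\neg_G x=x\Rightarrow_G 0$ and $x\Leftrightarrow_G y=(x\Rightarrow_G y)\wedge(y\Rightarrow_G x)$. In a chain, $x\Rightarrow_G y=1$ if $x\le y$ and $=y$ otherwise. An $IG$-algebra is a Gödel algebra with a unary ${\sim}$ such that, with $\Delta x:=\neg_G{\sim}x$: ${\sim}{\sim}x=x$; $\neg_G x\leq{\sim}x$; $\Delta(x\Rightarrow_G y)=\Delta({\sim}y\Rightarrow_G{\sim}x)$; $\Delta x\vee\neg_G\Delta x=1$; $\Delta(x\vee y)\leq\Delta x\vee\Delta y$; $\Delta(x\Rightarrow_G y)\leq\Delta x\Rightarrow_G\Delta y$. An $IG^\star$-algebra is an $IG$-algebra with a further unary operation $\star$ satisfying: ($\star1$) $\Delta(x\vee{\sim}x)=\Delta(x\Leftrightarrow_G\star x)$; ($\star2$) $\Delta(x\Rightarrow_G{\sim}x)=\neg_G\star x$; ($\star3$) ${\sim}\Delta(x\Rightarrow_G{\sim}x)\wedge{\sim}\Delta x\leq{\sim}\Delta(x\Rightarrow_G\star x)$; ($\star4$) $\Delta({\sim}x\Rightarrow_G x)\wedge\Delta({\sim}y\Rightarrow_G y)\wedge{\sim}\Delta(x\Rightarrow_G y)\leq{\sim}\Delta(\star x\Rightarrow_G\star y)$; ($\star5$) $\Delta({\sim}x\Rightarrow_G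 x)\wedge\Delta({\sim}y\Rightarrow_G y)\wedge\Delta(\star x\Leftrightarrow_G\star y)\leq\Delta(x\Leftrightarrow_G y)$. An $IG^\star$-chain is a linearly ordered $IG^\star$-algebra. $[0,1]^*_{MV}$ is the algebra on the real interval $[0,1]$ with $x\vee y=\max\{x,y\}$, negation $1-x$, square $*x=\max\{0,2x-1\}$ and constants $0,1$. A finite $IG^\star$-chain is representable if its implication-free reduct $(A,\vee,\star,{\sim},0,1)$ is embeddable into $[0,1]^*_{MV}$ (with $\star$ corresponding to $*$ and ${\sim}$ to $1-x$). An sk-sequence is a finite string of symbols from $\{\star,{\sim}\}$ of the form $[\star^{n_1},{\sim},\star^{n_2},{\sim},\ldots,{\sim},\star^{n_m}]$ with $m>1$, $n_1,\ldots,n_{m-1}>0$ and $n_m\geq0$, where $\star^{j}$ denotes $j$ consecutive symbols $\star$. For a string $R=[o_1,\ldots,o_k]$, $f_R(x)=o_k(o_{k-1}(\cdots o_1(x)\cdots))$; $(j)R$ is the concatenation of $j$ copies of $R$, and $f_{(0)R}$ is the identity. *)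

(* Defs.v *)
From HB Require Import structures.
From mathcomp Require Import all_boot all_order all_algebra.
From mathcomp Require Import reals.

Set Implicit Arguments.
Unset Strict Implicit.
Unset Printing Implicit Defensive.

Import Order.TTheory GRing.Theory Num.Theory.

Local Open Scope order_scope.

(* A bounded commutative residuated lattice whose monoid operation is the
   meet: integrality is automatic (the unit of the meet is \top), and
   residuation is gimpP. *)
HB.mixin Record isGodel d T & Order.TBLattice d T := {
  gimp : T -> T -> T;
  gimpP : forall x y z : T, (Order.meet x y <= z) = (x <= gimp y z);
  gimp_prelinear : forall x y : T, Order.join (gimp x y) (gimp y x) = \top
}.

#[short(type="godelType")]
HB.structure Definition Godel d := {T of Order.TBLattice d T & isGodel d T}.

Notation "x ⇒ y" := (gimp x y) (at level 60, right associativity) : order_scope.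

Section GodelOps.
Context {d : Order.disp_t} {T : godelType d}.
Definition gneg (x : T) : T := x ⇒ \bot.
Definition geqv (x y : T) : T := (x ⇒ y) `&` (y ⇒ x).
(* Delta relative to a candidate involution, so that it can be used in the
   axioms below. *)
Definition delta_of (inv : T -> T) (x : T) : T := gneg (inv x).
End GodelOps.

Notation "x ⇔ y" := (geqv x y) (at level 60, right associativity) : order_scope.

HB.mixin Record isIG d T & Godel d T := {
  inv : T -> T;
  invK : forall x : T, inv (inv x) = x;
  gneg_le_inv : forall x : T, gneg x <= inv x;
  delta_contra : forall x y : T,
    delta_of inv (x ⇒ y) = delta_of inv (inv y ⇒ inv x);
  delta_em : forall x : T, delta_of inv x `|` gneg (delta_of inv x) = \top;
  delta_join : forall x y : T,
    delta_of inv (x `|` y) <= delta_of inv x `|` delta_of inv y;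
  delta_imp : forall x y : T,
    delta_of inv (x ⇒ y) <= (delta_of inv x ⇒ delta_of inv y)
}.

#[short(type="igType")]
HB.structure Definition IG d := {T of Godel d T & isIG d T}.

Definition delta {d : Order.disp_t} {T : igType d} (x : T) : T :=
  delta_of inv x.

HB.mixin Record isIGStar d T & IG d T := {
  star : T -> T;
  star1 : forall x : T, delta (x `|` inv x) = delta (x ⇔ star x);
  star2 : forall x : T, delta (x ⇒ inv x) = gneg (star x);
  star3 : forall x : T,
    inv (delta (x ⇒ inv x)) `&` inv (delta x) <= inv (delta (x ⇒ star x));
  star4 : forall x y : T,
    delta (inv x ⇒ x) `&` delta (inv y ⇒ y) `&` inv (delta (x ⇒ y))
      <= inv (delta (star x ⇒ star y));
  star5 : forall x y : T,
    delta (inv x ⇒ x) `&` delta (inv y ⇒ y) `&` delta (star x ⇔ star y)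
      <= delta (x ⇔ y)
}.

#[short(type="igStarType")]
HB.structure Definition IGStar d := {T of IG d T & isIGStar d T}.

#[short(type="finIGStarChainType")]
HB.structure Definition FinIGStarChain d :=
  {T of IGStar d T & Order.FinTBTotal d T}.

Inductive gterm :=
  | GVar of nat
  | GBot
  | GTop
  | GMeet of gterm & gterm
  | GJoin of gterm & gterm
  | GImp of gterm & gterm.

Fixpoint geval d (T : godelType d) (v : nat -> T) (t : gterm) : T :=
  match t with
  | GVar i => v i
  | GBot => \bot
  | GTop => \top
  | GMeet t1 t2 => geval v t1 `&` geval v t2
  | GJoin t1 t2 => geval v t1 `|` geval v t2
  | GImp t1 t2 => geval v t1 ⇒ geval v t2
  end.

Definition gsat d (T : godelType d) (e : gterm * gterm) : Prop :=
  forall v : nat -> T, geval v e.1 = geval v e.2.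

(* The variety generated by G is the least equational class containing G, so
   T belongs to it iff T lies in every equational class that contains G. *)
Definition in_variety_generated_by d (G : godelType d) d' (T : godelType d') :
    Prop :=
  forall E : gterm * gterm -> Prop,
    (forall e, E e -> gsat G e) -> forall e, E e -> gsat T e.

(* The library declares the total order of 'I_n.+1 and its bounds separately;
   this infers their join, the bounded chain. *)
HB.saturate ordinal.

Section GodelChain.
Variable n : nat.
Implicit Types i j k : 'I_n.+1.

Definition ord_gimp i j : 'I_n.+1 := if (i <= j)%O then \top else j.

Lemma ord_gimpP i j k : (i `&` j <= k) = (i <= ord_gimp j k).
Proof.
rewrite /ord_gimp leIx; case: (leP j k) => [jk|kj]; first by rewrite orbT lex1.
by rewrite orbF.
Qed.

Lemma ord_gimp_prelinear i j : ord_gimp i j `|` ord_gimp j i = \top.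
Proof.
rewrite /ord_gimp; case: (leP i j) => [_|/ltW ->]; first by rewrite join1x.
by rewrite joinx1.
Qed.

HB.instance Definition _ :=
  isGodel.Build _ 'I_n.+1 ord_gimpP ord_gimp_prelinear.
End GodelChain.

Record ifree_algebra := IFreeAlgebra {
  if_car :> Type;
  if_join : if_car -> if_car -> if_car;
  if_star : if_car -> if_car;
  if_inv : if_car -> if_car;
  if_bot : if_car;
  if_top : if_car
}.

Definition embeddable (A B : ifree_algebra) : Prop :=
  exists f : A -> B,
    injective f /\
    [/\ forall x y, f (if_join x y) = if_join (f x) (f y),
        forall x, f (if_star x) = if_star (f x),
        forall x, f (if_inv x) = if_inv (f x),
        f (if_bot A) = if_bot B
      & f (if_top A) = if_top B].

Definition ifree_reduct d (A : igStarType d) : ifree_algebra :=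
  @IFreeAlgebra A Order.join star inv \bot \top.

Section StandardMV.
Local Open Scope ring_scope.
Variable R : realType.

Definition unit_itv : Type := {x : R | 0 <= x <= 1}.
Implicit Types u v : unit_itv.

Fact ui_join_subproof u v : 0 <= Num.max (sval u) (sval v) <= 1.
Proof.
case: u v => [x /andP[x0 x1]] [y /andP[_ y1]] /=.
by rewrite le_max x0 ge_max x1 y1.
Qed.

Fact ui_star_subproof u : 0 <= Num.max 0 (2 * sval u - 1) <= 1.
Proof.
case: u => [x /andP[_ x1]] /=.
by rewrite le_max lexx ge_max ler01 lerBlDl mulr_natl mulr2n lerD.
Qed.

Fact ui_inv_subproof u : 0 <= 1 - sval u <= 1.
Proof. by case: u => [x /andP[x0 x1]] /=; rewrite subr_ge0 x1 gerBl. Qed.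

Fact ui_bot_subproof : 0 <= (0 : R) <= 1.
Proof. by rewrite lexx ler01. Qed.

Fact ui_top_subproof : 0 <= (1 : R) <= 1.
Proof. by rewrite lexx ler01. Qed.

Definition mv_star : ifree_algebra :=
  @IFreeAlgebra unit_itv
    (fun u v => exist _ (Num.max (sval u) (sval v)) (ui_join_subproof u v))
    (fun u => exist _ (Num.max 0 (2 * sval u - 1)) (ui_star_subproof u))
    (fun u => exist _ (1 - sval u) (ui_inv_subproof u))
    (exist _ 0 ui_bot_subproof)
    (exist _ 1 ui_top_subproof).
End StandardMV.

Definition representable (R : realType) d (A : finIGStarChainType d) : Prop :=
  embeddable (ifree_reduct A) (mv_star R).

Inductive sk_symbol := SkStar | SkInv.

(* ns lists n_1, ..., n_(m-1), so that m > 1 amounts to ns != [::], and nm is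
   n_m. *)
Definition is_sk (s : seq sk_symbol) : Prop :=
  exists (ns : seq nat) (nm : nat),
    [/\ ns != [::],
        all (fun k => (0 < k)%N) ns
      & s = flatten [seq rcons (nseq k SkStar) SkInv | k <- ns]
              ++ nseq nm SkStar].

Definition sk_repeat (j : nat) (s : seq sk_symbol) : seq sk_symbol :=
  flatten (nseq j s).

Section SkEval.
Context {d : Order.disp_t} {A : igStarType d}.

Definition sk_apply (o : sk_symbol) (x : A) : A :=
  match o with SkStar => star x | SkInv => inv x end.

Definition sk_eval (s : seq sk_symbol) (x : A) : A :=
  foldl (fun y o => sk_apply o y) x s.
End SkEval.

Definition sat_R1 d (A : igStarType d) (s : seq sk_symbol) (r : nat) : Prop :=
  forall x y : A,
    inv x `|` x `|` (x ⇔ y) `|`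
      (delta (sk_eval s x ⇔ y)
         ⇒ inv (delta (sk_eval (sk_repeat r.-1 s) y ⇔ x)))
    = \top.

Definition sat_R2 d (A : igStarType d) (s : seq sk_symbol) : Prop :=
  forall x y : A,
    inv x `|` x `|` inv y `|` y `|`
      (delta ((sk_eval s x ⇔ x) `&` (sk_eval s y ⇔ y)) ⇒ delta (x ⇔ y))
    = \top.

(* Main.v *)
Require Import Defs.
From mathcomp Require Import all_boot all_order all_algebra.
From mathcomp Require Import reals.
From mathcomp Require boolp.
From mathcomp Require Import lra.
Require Import Defs.

Set Implicit Arguments.
Unset Strict Implicit.
Unset Printing Implicit Defensive.

Import Order.TTheory GRing.Theory Num.Theory.

Local Open Scope order_scope.

(** Representability is a question about a folding map of the chain, and the
proof is symbolic dynamics for that map.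

In a chain, Delta is the indicator of the top element, so the axioms say that
inv is an order-reversing involution, that star vanishes exactly below the
middle (where x <= inv x), is strictly increasing above it, and satisfies
star x < x there except at the top.  Let step apply star to an element above
the middle and inv to the others.  On the real interval the orbits of step are
those of the map sending x to |2 x - 1|, with its reflections spelled out; the
itinerary of x records which points of its orbit lie above the middle.

An embedding f must satisfy f x = (1 + f (star x)) / 2 above the middle and
f x = (1 - f (star (inv x))) / 2 elsewhere.  On a finite chain this system is
contracting, so it has a solution ([contraction_fixpoint]), and a solution
commutes with all operations except perhaps the join.  If the orbits of
x < y separate at some time, following the strictly monotone branches back from
that time gives f x < f y ([value_lt_separated]).  Hence the chain is
representable as soon as distinct elements have distinct itineraries
([representable_of_same_itinerary_eq]).

Suppose now that x and y share an itinerary.  Both are eventually periodic and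
step is injective along equal itineraries, so they may be taken periodic, of
least periods p and q.  The common itinerary then has period k = gcd p q.  Only
the top element stays above the middle forever, and at most one element stays
below it, so the orbits visit both sides and never spend two consecutive times
below.  Starting just after a visit below the middle, the operations performed
during one period form a sk-sequence s of length k.  Equation (R1) with
r = p / k forbids that x return to itself under the r-th iterate of s without
being fixed by s; so x, and likewise y, is fixed by s, and (R2) yields x = y
([same_itinerary_eq]).  The side condition r * k = p <= n + 1 holds because a
chain in the variety generated by the (n + 1)-element chain has at most n + 1
elements ([variety_card]).

Conversely, inside the real interval every star that does not produce 0 doubles
distances and every inv preserves them, so a sequence of operations that
contains a star has at most one fixed point other than 0 and 1
([sk_fixpoint_unique]); both equations follow from this. *)

(** * The axioms in a chain *)

Section Chain.
Context {d : Order.disp_t} {A : finIGStarChainType d}.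
Implicit Types x y z : A.

Lemma gimp_chainE x y : (x ⇒ y) = if x <= y then \top else y.
Proof.
case: (leP x y) => [xy|yx]; apply/le_anti.
  by rewrite lex1 /= -gimpP meet1x.
have yI : y <= (x ⇒ y) by rewrite -gimpP leIx lexx.
rewrite yI andbT; have := lexx (x ⇒ y); rewrite -gimpP leIx.
by rewrite (leNgt x) yx orbF.
Qed.

Lemma gimp_eq1 x y : ((x ⇒ y) == \top) = (x <= y).
Proof.
rewrite gimp_chainE; case: leP => [_|yx]; first exact: eqxx.
by apply/negbTE/negP => /eqP y1; move: yx; rewrite y1 ltNge lex1.
Qed.

Lemma inv0 : inv (\bot : A) = \top.
Proof.
apply/eqP; rewrite eq_le lex1 /=.
by have := gneg_le_inv (\bot : A); rewrite /gneg gimp_chainE lexx.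
Qed.

Lemma inv1 : inv (\top : A) = \bot.
Proof. by rewrite -inv0 invK. Qed.

Lemma inv_inj : injective (@inv _ A).
Proof. exact: can_inj (@invK _ A). Qed.

Lemma inv_eq1 x : (inv x == \top) = (x == \bot).
Proof. by rewrite -inv0 (inj_eq inv_inj). Qed.

Lemma join_eq1 x y : (x `|` y == \top) = (x == \top) || (y == \top).
Proof. by rewrite -!le1x lexU. Qed.

Lemma meet_eq1 x y : (x `&` y == \top) = (x == \top) && (y == \top).
Proof. by rewrite -!le1x lexI. Qed.

Lemma geqv_eq1 x y : ((x ⇔ y) == \top) = (x == y).
Proof. by rewrite meet_eq1 !gimp_eq1 eq_le. Qed.

Hypothesis A_nontrivial : (\bot : A) <> \top.

Lemma bot_neq_top : ((\bot : A) == \top) = false.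
Proof. exact/eqP. Qed.

Lemma deltaE x : delta x = if x == \top then \top else \bot.
Proof.
rewrite /delta /delta_of /gneg gimp_chainE lex0 -inv1 (inj_eq inv_inj).
by rewrite inv1.
Qed.

Lemma delta_eq1 x : (delta x == \top) = (x == \top).
Proof. by rewrite deltaE; case: ifP; rewrite ?eqxx ?bot_neq_top. Qed.

Lemma inv_delta_eq1 x : (inv (delta x) == \top) = (x != \top).
Proof.
rewrite inv_eq1 deltaE; case: (x == \top); rewrite ?eqxx //.
by rewrite eq_sym bot_neq_top.
Qed.

Lemma le1_trans x y : x <= y -> x == \top -> y == \top.
Proof. by move=> xy /eqP x1; rewrite -le1x -x1. Qed.

Lemma le_inv x y : (inv y <= inv x) = (x <= y).
Proof.
have := delta_contra x y => /(congr1 (eq_op^~ \top)).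
by rewrite -!/(delta _) !delta_eq1 !gimp_eq1.
Qed.

Lemma lt_inv x y : (inv y < inv x) = (x < y).
Proof. by rewrite !ltNge le_inv. Qed.

Lemma star_eq0 x : (star x == \bot) = (x <= inv x).
Proof.
have /(congr1 (eq_op^~ \top)) := star2 x.
by rewrite delta_eq1 gimp_eq1 /gneg gimp_eq1 lex0 => ->.
Qed.

Lemma star_top : star (\top : A) = \top.
Proof.
have /(congr1 (eq_op^~ \top)) := star1 (\top : A).
by rewrite !delta_eq1 geqv_eq1 join_eq1 eqxx => /esym/eqP.
Qed.

(** This is what the third star axiom says in a chain; it makes repeated
application of star descend until it leaves the upper half. *)
Lemma star_lt x : inv x < x -> x != \top -> star x < x.
Proof.
move=> xp x1; rewrite ltNge -gimp_eq1 -inv_delta_eq1.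
apply: le1_trans (star3 x) _.
by rewrite meet_eq1 !inv_delta_eq1 gimp_eq1 -ltNge xp.
Qed.

Lemma star_mono x y : inv x <= x -> inv y <= y -> x < y -> star x < star y.
Proof.
move=> xp yp xy; rewrite ltNge -gimp_eq1 -inv_delta_eq1.
apply: le1_trans (star4 y x) _.
by rewrite !meet_eq1 inv_delta_eq1 !delta_eq1 !gimp_eq1 xp yp -ltNge.
Qed.

(** Since Delta is two-valued, (R1) is an implication between equalities. The
hypothesis of (R1) determines y as the value of s at x. *)
Lemma sat_R1P s r :
  sat_R1 A s r <->
  (forall x, x != \bot -> x != \top -> sk_eval s x != x ->
     sk_eval (sk_repeat r.-1 s) (sk_eval s x) != x).
Proof.
split=> [R1 x x0 x1 xy|R1 x y]; last first.
  apply/eqP; rewrite !join_eq1 inv_eq1 geqv_eq1 gimp_eq1.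
  have [//|x0] := eqVneq x \bot; have [//|x1] := eqVneq x \top.
  have [//|xy] := eqVneq x y => /=.
  rewrite deltaE geqv_eq1; have [sxy|_] := eqVneq; last exact: le0x.
  by rewrite le1x inv_delta_eq1 geqv_eq1 -{1}sxy R1 // sxy eq_sym.
have /eqP := R1 x (sk_eval s x).
rewrite !join_eq1 inv_eq1 geqv_eq1 gimp_eq1 (negbTE x0) (negbTE x1) eq_sym.
rewrite (negbTE xy) /= (deltaE (_ ⇔ _)) geqv_eq1 eqxx le1x inv_delta_eq1.
by rewrite geqv_eq1.
Qed.

Lemma sat_R2P s :
  sat_R2 A s <->
  (forall x y, x != \bot -> x != \top -> y != \bot -> y != \top ->
     sk_eval s x = x -> sk_eval s y = y -> x = y).
Proof.
split=> [R2 x y x0 x1 y0 y1 sx sy|R2 x y].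
  have /eqP := R2 x y.
  rewrite !join_eq1 !inv_eq1 gimp_eq1 (negbTE x0) (negbTE x1) (negbTE y0).
  rewrite (negbTE y1) !deltaE meet_eq1 !geqv_eq1 sx sy !eqxx /= le1x.
  by case: (eqVneq x y) => // _; rewrite bot_neq_top.
apply/eqP; rewrite !join_eq1 !inv_eq1 gimp_eq1.
have [//|x0] := eqVneq x \bot; have [//|x1] := eqVneq x \top.
have [//|y0] := eqVneq y \bot; have [//|y1] := eqVneq y \top.
rewrite /= !deltaE meet_eq1 !geqv_eq1; case: ifP => [/andP[/eqP sx /eqP sy]|_].
  by rewrite (R2 x y) // eqxx.
exact: le0x.
Qed.
End Chain.

(** * Iteration and order in finite types *)

Lemma iter_period (T : Type) (f : T -> T) (x : T) p m :
  iter p f x = x -> iter (m * p) f x = x.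
Proof. by move=> px; rewrite iterM iter_fix. Qed.

Lemma eventually_periodic (T : finType) (f : T -> T) (x : T) :
  exists N k, iter k.+1 f (iter N f x) = iter N f x.
Proof.
have /trajectP[i lt_i eq_i] := looping_order f x.
exists i, (order f x - i).-1.
by rewrite prednK ?subn_gt0 // -iterD subnK ?(ltnW lt_i).
Qed.

Lemma fin_lt_ind (d : Order.disp_t) (T : finPOrderType d) (P : T -> Prop) :
  (forall x, (forall y, y < x -> P y) -> P x) -> forall x, P x.
Proof.
move=> IH x; have [m] := ubnP #|[set z | z < x]|.
elim: m x => // m IHm x lt_m; apply: IH => y yx; apply: IHm.
apply: leq_trans (proper_card _) lt_m.
rewrite properE; apply/andP; split; apply/subsetP.
  by move=> z; rewrite !inE => /lt_trans; apply.
by move/(_ y); rewrite !inE yx ltxx => /(_ isT).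
Qed.

Lemma sk_eval_cat (d : Order.disp_t) (A : igStarType d) s1 s2 (x : A) :
  sk_eval (s1 ++ s2) x = sk_eval s2 (sk_eval s1 x).
Proof. exact: foldl_cat. Qed.

(** * Itineraries of the folding map *)

Section Fold.
Context {d : Order.disp_t} {A : finIGStarChainType d}.
Implicit Types x y z : A.
Hypothesis A_nontrivial : (\bot : A) <> \top.

Definition upper x := inv x < x.
Definition step x := if upper x then star x else inv x.
Definition same_itinerary x y :=
  forall i, upper (iter i step x) = upper (iter i step y).

Lemma upper_le x y : x <= y -> upper x -> upper y.
Proof.
move=> xy xu; apply: (lt_le_trans _ xy); apply: (le_lt_trans _ xu).
by rewrite (le_inv A_nontrivial).
Qed.

Lemma upperN x : ~~ upper x = (x <= inv x).
Proof. by rewrite leNgt. Qed.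

Lemma upper1 : upper (\top : A).
Proof. by rewrite /upper inv1 lt0x eq_sym (bot_neq_top A_nontrivial). Qed.

Lemma upper0 : upper (\bot : A) = false.
Proof. by rewrite /upper ltx0. Qed.

Lemma step1 : step (\top : A) = \top.
Proof. by rewrite /step upper1 (star_top A_nontrivial). Qed.

Lemma star_inj x y : upper x -> upper y -> star x = star y -> x = y.
Proof.
move=> xu yu sxy; apply/eqP; case: ltgtP => // xy.
  by have := star_mono A_nontrivial (ltW xu) (ltW yu) xy; rewrite sxy ltxx.
by have := star_mono A_nontrivial (ltW yu) (ltW xu) xy; rewrite sxy ltxx.
Qed.

Lemma step_inj x y : upper x = upper y -> step x = step y -> x = y.
Proof.
rewrite /step => xy; rewrite -xy; case: ifP => [xu|_ /inv_inj //].
by apply: star_inj => //; rewrite -xy.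
Qed.

(** An element of the lower half whose involute is in the lower half too is the
midpoint of the chain, that is, the fixed point of inv. *)
Lemma lower_fixed_unique x y :
  ~~ upper x -> ~~ upper (step x) -> ~~ upper y -> ~~ upper (step y) -> x = y.
Proof.
move=> xl; rewrite /step (negbTE xl) upperN invK => xl' yl.
rewrite (negbTE yl) upperN invK => yl'.
have ix : inv x = x by apply/le_anti; rewrite xl' -upperN.
have iy : inv y = y by apply/le_anti; rewrite yl' -upperN.
wlog xy : x y {xl xl' yl yl'} ix iy / x <= y.
  by move=> H; case: (leP x y) => [|/ltW] xy; [|symmetry]; exact: H.
by apply/le_anti; rewrite xy -ix -iy (le_inv A_nontrivial).
Qed.

(** While the orbit stays in the upper half and off the top, star strictly
decreases it; in a finite chain this cannot go on. *)
Lemma always_upper x : (forall i, upper (iter i step x)) -> x = \top.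
Proof.
elim/fin_lt_ind: x => x IH xu; apply/eqP/negP => /negP x1.
have sx : step x < x.
  by have := xu 0%N; rewrite /step /= => ux; rewrite ux (star_lt A_nontrivial).
have sx1 : step x = \top by apply: IH => // i; rewrite -iterSr.
by move: sx; rewrite sx1 ltNge lex1.
Qed.

Definition itinerary k x : seq sk_symbol :=
  [seq if upper z then SkStar else SkInv | z <- traject step x k].

Lemma size_itinerary k x : size (itinerary k x) = k.
Proof. by rewrite size_map size_traject. Qed.

Lemma sk_eval_itinerary k x z :
  same_itinerary x z -> sk_eval (itinerary k x) z = iter k step z.
Proof.
elim: k x z => // k IH x z xz.
have xz1 : same_itinerary (step x) (step z).
  by move=> i; have := xz i.+1; rewrite !iterSr.
rewrite iterSr -(IH _ _ xz1) /itinerary trajectS /sk_eval /=; congr foldl.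
by rewrite [in RHS]/step (xz 0%N : upper x = upper z); case: (upper z).
Qed.

(** When the itinerary of x has period k, its first k symbols describe every
block of k steps, so repeating them keeps following the orbit. *)
Lemma sk_eval_itinerary_repeat k j x z :
  same_itinerary x z -> same_itinerary x (iter k step x) ->
  sk_eval (sk_repeat j (itinerary k x)) z = iter (j * k) step z.
Proof.
elim: j z => // j IH z xz xk.
rewrite mulSn addnC iterD -[iter k step z](sk_eval_itinerary k xz) -IH //.
  by rewrite /sk_repeat /= sk_eval_cat.
move=> i; rewrite sk_eval_itinerary // xk.
by rewrite -!iterD xz.
Qed.

Lemma eq_itinerary k x y :
  same_itinerary x y -> itinerary k x = itinerary k y.
Proof.
elim: k x y => // k IH x y xy; rewrite /itinerary !trajectS !map_cons.
rewrite -!/(itinerary _ _) (xy 0%N : upper x = upper y).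
rewrite (IH (step x) (step y)) //.
by move=> i; rewrite -!iterSr xy.
Qed.

(** The first block is the only one that may consist of an inv alone, because
any later one follows a point of the lower half, whose image lies in the upper
half. *)
Lemma itinerary_blocks k x :
  (forall i, ~~ upper (iter i step x) -> upper (iter i.+1 step x)) ->
  ~~ upper (iter k step x) ->
  exists n0 ns, [/\ upper x -> (0 < n0)%N, all (fun m => (0 < m)%N) ns
    & itinerary k.+1 x
      = flatten [seq rcons (nseq m SkStar) SkInv | m <- n0 :: ns]].
Proof.
elim: k x => [|k IH] x alt xk.
  exists 0%N, [::]; split => //=; first by rewrite (negbTE xk).
  by rewrite /itinerary /= (negbTE xk).
have [i||n0 [ns [n0_gt0 ns_gt0 eq_ns]]] := IH (step x).
- by rewrite -!iterSr; exact: alt.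
- by rewrite -iterSr.
rewrite /itinerary trajectS map_cons -/(itinerary _ _) eq_ns.
case: ifPn => xu.
  by exists n0.+1, ns.
exists 0%N, (n0 :: ns); split => //=.
by rewrite ns_gt0 n0_gt0 //; exact: (alt 0%N).
Qed.

Lemma itinerary_sk k x :
  (forall i, ~~ upper (iter i step x) -> upper (iter i.+1 step x)) ->
  upper x -> ~~ upper (iter k step x) -> is_sk (itinerary k.+1 x).
Proof.
move=> alt xu xk.
have [n0 [ns [n0_gt0 ns_gt0 eq_ns]]] := itinerary_blocks alt xk.
by exists (n0 :: ns), 0%N; split=> //=; rewrite ?n0_gt0 // cats0.
Qed.

Lemma same_itinerary_shift j x y :
  same_itinerary x y -> same_itinerary (iter j step x) (iter j step y).
Proof. by move=> xy i; rewrite -!iterD xy. Qed.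

Lemma same_itinerary_iter_inj j x y :
  same_itinerary x y -> iter j step x = iter j step y -> x = y.
Proof.
elim: j x y => // j IH x y xy; rewrite !iterSr => eq_j.
apply: step_inj (xy 0%N) _; apply: IH eq_j.
exact: (same_itinerary_shift 1).
Qed.

(** Bezout: a multiple of p equals gcd p q plus a multiple of q. Shifting the
common itinerary by a multiple of p (seen on x) or of q (seen on y) does not
change it, hence neither does shifting it by gcd p q. *)
Lemma itinerary_gcd_period p q x y :
  (0 < p)%N -> iter p step x = x -> iter q step y = y -> same_itinerary x y ->
  same_itinerary x (iter (gcdn p q) step x).
Proof.
move=> p_gt0 px qy xy i; case: (egcdnP q p_gt0) => km kn eq_k _.
have shift j : upper (iter (j + kn * q) step x) = upper (iter j step x).
  by rewrite !xy iterD iter_period.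
rewrite -iterD -(shift (i + gcdn p q)%N) -addnA [(gcdn _ _ + _)%N]addnC -eq_k.
by rewrite iterD iter_period.
Qed.

Variable n : nat.
Hypothesis card_A : (#|A| <= n + 1)%N.
Hypothesis A_sat : forall s, is_sk s -> forall r : nat, (1 <= r)%N ->
  (r * size s <= n + 1)%N -> sat_R1 A s r /\ sat_R2 A s.

(** The period used with (R1) must be at most n + 1, so an arbitrary period is
replaced by the size of the orbit. *)
Lemma periodic_order x k : iter k.+1 step x = x ->
  [/\ (0 < order step x)%N, (order step x <= n + 1)%N &
      iter (order step x) step x = x].
Proof.
move=> kx; split; first exact: order_gt0.
  exact: leq_trans (max_card _) card_A.
by apply: (all_iffLR orbitPcycle 3 4); exists k.
Qed.

(** (R1) says that a cycle cannot be longer than the period of its itinerary: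
otherwise x would return to itself after p / k rounds of its word, having moved
in the first one. *)
Lemma itinerary_period k p x :
  (p <= n + 1)%N -> (k.+1 %| p)%N -> (0 < p)%N -> iter p step x = x ->
  is_sk (itinerary k.+1 x) -> x != \bot -> x != \top ->
  same_itinerary x (iter k.+1 step x) -> iter k.+1 step x = x.
Proof.
move=> p_le /dvdnP[[|r] p_eq] p_gt0 px sk x0 x1 xk.
  by rewrite p_eq in p_gt0.
have refl_x : same_itinerary x x by [].
have [|R1 _] := A_sat sk (ltn0Sn r); first by rewrite size_itinerary -p_eq.
apply/eqP/negPn/negP => kx.
have := iffLR (sat_R1P A_nontrivial _ _) R1 x x0 x1.
rewrite sk_eval_itinerary // succnK => /(_ kx).
by rewrite sk_eval_itinerary_repeat // -iterD addnC -mulSn -p_eq px eqxx.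
Qed.

(** The orbits are first rotated so that they start just after a visit to the
lower half: the word of one period then begins with star and ends with inv,
which makes it a sk-sequence, and (R2) applies to it. *)
Lemma periodic_same_itinerary_eq x y k :
  iter k.+1 step x = x -> iter k.+1 step y = y -> same_itinerary x y -> x = y.
Proof.
move=> kx ky xy; apply/eqP/negPn/negP => /eqP neq_xy.
have xy_iter i : iter i step x <> iter i step y.
  by move/(same_itinerary_iter_inj xy).
have [j xj] : exists j, ~~ upper (iter j step x).
  have [/forallP xu|/forallPn[j xj]] :=
    boolP [forall j : 'I_k.+1, upper (iter j step x)]; last by exists j.
  have {}xu i : upper (iter i step x).
    rewrite (divn_eq i k.+1) addnC iterD iter_period //.
    exact: (xu (Ordinal (ltn_pmod i (ltn0Sn k)))).
  case: neq_xy; rewrite [x]always_upper // [y]always_upper // => i.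
  by rewrite -xy.
(* Otherwise both orbits would sit at the midpoint at time i. *)
have alt i : ~~ upper (iter i step x) -> upper (iter i.+1 step x).
  move=> xi; apply/negPn/negP => xi1; apply: (xy_iter i).
  by apply: lower_fixed_unique; rewrite // -?iterS -xy.
have [p_gt0 p_le px] := periodic_order kx.
have [q_gt0 q_le qy] := periodic_order ky.
set p := order step x in p_gt0 p_le px; set q := order step y in q_gt0 q_le qy.
have := itinerary_gcd_period p_gt0 px qy xy.
have := dvdn_gcdl p q; have := dvdn_gcdr p q.
have : (0 < gcdn p q)%N by rewrite gcdn_gt0 p_gt0.
case: (gcdn p q) => // m _ mq mp xm.
pose x' := iter j.+1 step x; pose y' := iter j.+1 step y.
have xy' : same_itinerary x' y' := same_itinerary_shift j.+1 xy.
have xm' : same_itinerary x' (iter m.+1 step x').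
  by move=> i; rewrite -!iterD xm -iterD -!addnA (addnC m.+1).
have alt' i : ~~ upper (iter i step x') -> upper (iter i.+1 step x').
  by rewrite -!iterD; exact: alt.
have x'u : upper x' by exact: alt.
have x'm : ~~ upper (iter m step x').
  by rewrite -iterD addnS -addSn addnC iterD -xm.
have sk := itinerary_sk alt' x'u x'm.
have nontop z : same_itinerary x' z -> z != \bot /\ z != \top.
  move=> xz; split; apply/eqP => z_eq.
    by have := xz 0%N; rewrite /= x'u z_eq upper0.
  by have := xz m; rewrite (negbTE x'm) z_eq iter_fix ?upper1 // step1.
have [x0 x1] : x' != \bot /\ x' != \top by exact: nontop.
have [y0 y1] := nontop _ xy'.
have px' : iter p step x' = x' by rewrite -iterD addnC iterD px.
have qy' : iter q step y' = y' by rewrite -iterD addnC iterD qy.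
have eq_it := eq_itinerary m.+1 xy'.
have ym' : same_itinerary y' (iter m.+1 step y').
  by move=> i; rewrite -xy' xm' -iterD xy' iterD.
have mx := itinerary_period p_le mp p_gt0 px' sk x0 x1 xm'.
have my : iter m.+1 step y' = y'.
  by apply: itinerary_period qy' _ y0 y1 ym'; rewrite -?eq_it.
have [|_ R2] := A_sat sk (ltn0Sn 0).
  by rewrite size_itinerary mul1n; apply: leq_trans p_le; exact: dvdn_leq.
apply: (xy_iter j.+1); apply: (iffLR (sat_R2P A_nontrivial _) R2) => //.
  by rewrite sk_eval_itinerary.
by rewrite sk_eval_itinerary.
Qed.

(** The orbit of the pair under the product map reaches a cycle, which makes
both components periodic at the same time; injectivity along equal itineraries
then transports the equality back to time 0. *)
Lemma same_itinerary_eq x y : same_itinerary x y -> x = y.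
Proof.
move=> xy; pose f (z : A * A) := (step z.1, step z.2).
have fE i : iter i f (x, y) = (iter i step x, iter i step y).
  by elim: i => //= i ->.
have [N [k]] := eventually_periodic f (x, y).
rewrite -iterD !fE !iterD => -[kx ky].
apply: (same_itinerary_iter_inj (j := N)) => //.
by apply: periodic_same_itinerary_eq kx ky _; exact: same_itinerary_shift.
Qed.
End Fold.

(** * Cardinality of chains in the generated variety *)

Section VarietyCard.
Context {d : Order.disp_t} {A : finIGStarChainType d}.

(** The join of the k terms x_(i+1) => x_i, over i < k: in a chain it is the
top as soon as some x_(i+1) <= x_i, and in a nontrivial chain only then. The
variables x_0, ..., x_k cannot increase strictly in a chain of at most k
elements. *)
Definition descent_term k : gterm :=
  foldr (fun i => GJoin (GImp (GVar i.+1) (GVar i))) GBot (iota 0 k).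

Lemma descent_term_sat n : gsat 'I_n.+1 (descent_term n.+1, GTop).
Proof.
move=> v; change (geval v (descent_term n.+1) = \top).
set s := iota 0 n.+1.
have [i si vi] : exists2 i, i \in s & v i.+1 <= v i.
  apply/hasP/negPn/negP => /hasPn ltv.
  (* A strictly increasing valuation would dominate the identity. *)
  have ge_v k : (k <= n.+1)%N -> (k <= v k)%N.
    elim: k => // k IH kn; apply: leq_ltn_trans (IH (ltnW kn)) _.
    by have := ltv k; rewrite mem_iota => /(_ kn); rewrite -ltNge.
  by have := ge_v n.+1 (leqnn _); rewrite leqNgt ltn_ord.
rewrite /descent_term -/s; elim: s si => //= j s IH; rewrite inE.
case: eqP => [<- _|_ /= /IH ->]; last by rewrite joinx1.
have -> : (v i.+1 ⇒ v i) = \top :> 'I_n.+1 by rewrite /gimp /= /ord_gimp vi.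
by rewrite join1x.
Qed.

Lemma descent_term_unsat (v : nat -> A) k :
  (\bot : A) <> \top -> (forall i, (i < k)%N -> v i < v i.+1) ->
  geval v (descent_term k) <> \top.
Proof.
move=> bt ltv; rewrite /descent_term.
have : all (fun i => (i < k)%N) (iota 0 k).
  by apply/allP => i; rewrite mem_iota.
elim: (iota 0 k) => //= i s IH /andP[ik sk] /eqP.
rewrite join_eq1 gimp_eq1 leNgt ltv //= => /eqP; exact: IH.
Qed.

(** In a chain with at least n + 2 elements, an increasing enumeration refutes
an equation that holds in the chain with n + 1 elements. *)
Lemma variety_card n : (\bot : A) <> \top ->
  in_variety_generated_by 'I_n.+1 A -> (#|A| <= n + 1)%N.
Proof.
move=> bt Avar; rewrite leqNgt addn1; apply/negP => lt_nA.
have sat : gsat A (descent_term n.+1, GTop).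
  apply: (Avar (eq^~ (descent_term n.+1, GTop))) => // _ ->.
  exact: descent_term_sat.
set s := sort <=%O (enum A).
have size_s : size s = #|A| by rewrite size_sort -cardE.
have lt_s : sorted <%O s by rewrite sort_lt_sorted enum_uniq.
apply: (@descent_term_unsat (nth \bot s) n.+1 bt).
  move=> i ni; rewrite lt_sorted_ltn_nth ?inE ?size_s //.
    exact: ltn_trans lt_nA.
  exact: leq_ltn_trans lt_nA.
exact: sat.
Qed.
End VarietyCard.

(** * The recursive system for the embedding *)

Section Contraction.
Local Open Scope ring_scope.

(** The system is linear with square matrix 1 - B, and B shrinks the sup norm,
so 1 - B has trivial kernel and is invertible. *)
Lemma contraction_fixpoint (F : realFieldType) (T : finType) (t : T -> T)
    (b c : T -> F) :
  (forall x, `|b x| < 1) ->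
  exists f : T -> F, forall x, f x = c x + b x * f (t x).
Proof.
move=> b_lt1; pose m := #|T|.
pose B : 'M[F]_m := \matrix_(j, i)
  (b (enum_val i) *+ (j == enum_rank (t (enum_val i)))).
have mulB (v : 'rV_m) i :
    (v *m B) 0 i = b (enum_val i) * v 0 (enum_rank (t (enum_val i))).
  rewrite mxE (bigD1 (enum_rank (t (enum_val i)))) //= mxE eqxx mulr1n mulrC.
  rewrite big1 ?addr0 // => j /negbTE ji.
  by rewrite mxE ji mulr0n mulr0.
have unitB : 1%:M - B \in unitmx.
  rewrite unitmxE unitfE; apply/det0P => -[v /rV0Pn[i0 vi0] /eqP].
  rewrite mulmxBr mulmx1 subr_eq0 => /eqP vB.
  (* At an entry of v of maximal norm, v = v *m B contradicts maximality. *)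
  case: (@arg_maxP _ _ _ i0 predT (fun i => `|v 0 i|) isT) => i _ max_i.
  have vi : 0 < `|v 0 i|.
    by apply: lt_le_trans (max_i i0 isT); rewrite normr_gt0.
  have /(_ isT) /= max_t := max_i (enum_rank (t (enum_val i))).
  have : `|v 0 i| < `|v 0 i|; last by rewrite ltxx.
  rewrite {1}vB mulB normrM.
  apply: le_lt_trans (ler_wpM2l (normr_ge0 _) max_t) _.
  by rewrite gtr_pMl.
have [v vE] : exists v, v *m (1%:M - B) = \row_i c (enum_val i).
  by exists (\row_i c (enum_val i) *m invmx (1%:M - B)); rewrite mulmxKV.
exists (fun x => v 0 (enum_rank x)) => x.
have := congr1 (fun w : 'rV_m => w 0 (enum_rank x)) vE.
rewrite mulmxBr mulmx1 mxE [RHS]mxE mxE mulB !enum_rankK => /eqP.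
by rewrite subr_eq => /eqP.
Qed.
End Contraction.

Section Representation.
Local Open Scope ring_scope.
Variable R : realType.
Context {d : Order.disp_t} {A : finIGStarChainType d}.
Implicit Types x y z : A.
Hypothesis A_nontrivial : (\bot : A) <> \top.

Lemma value_exists : exists f : A -> R, forall x,
  f x = if upper x then (1 + f (star x)) / 2 else (1 - f (star (inv x))) / 2.
Proof.
pose t x : A := if upper x then star x else star (inv x).
have b_lt1 x : `|if upper x then 2^-1 else - 2^-1 : R| < 1.
  by case: ifP => _; rewrite ?normrN gtr0_norm; lra.
have [f fE] := @contraction_fixpoint R _ t _ (fun=> 2^-1) b_lt1.
by exists f => x; rewrite fE /t; case: ifP => _; lra.
Qed.

Section Value.
Variable f : A -> R.
Hypothesis fE : forall x,
  f x = if upper x then (1 + f (star x)) / 2 else (1 - f (star (inv x))) / 2.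

(** At a point of maximal norm m, the recursion gives m <= (1 + m) / 2. *)
Lemma value_norm x : `|f x| <= 1.
Proof.
case: (@arg_maxP _ _ _ x predT (fun z => `|f z|) isT) => z _ max_z.
apply: le_trans (max_z x isT) _.
have [w] : exists w, f z = (1 + f w) / 2 \/ f z = (1 - f w) / 2.
  rewrite fE; case: ifP => _; first by exists (star z); left.
  by exists (star (inv z)); right.
have w_le := ler_norm (f w).
have := ler_norm (- f w); rewrite normrN => w_ge fz.
suff : `|f z| <= (1 + `|f w|) / 2 by have /= max_w := max_z w isT; lra.
by rewrite ler_norml; case: fz => ->; apply/andP; split; lra.
Qed.

Lemma value_ge0 x : 0 <= f x.
Proof.
rewrite fE; have := value_norm (star x); have := value_norm (star (inv x)).
by rewrite !ler_norml => /andP[? ?] /andP[? ?]; case: ifP => _; lra.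
Qed.

Lemma value_le1 x : f x <= 1.
Proof. by have := value_norm x; rewrite ler_norml => /andP[]. Qed.

Lemma value1 : f \top = 1.
Proof.
by have := fE \top; rewrite (upper1 A_nontrivial) (star_top A_nontrivial); lra.
Qed.

Lemma value0 : f \bot = 0.
Proof.
have := fE \bot; rewrite upper0 inv0 (star_top A_nontrivial) value1.
lra.
Qed.

Lemma value_lower x : ~~ upper x -> f x <= 2^-1.
Proof.
by move=> /negbTE xl; rewrite fE xl; have := value_ge0 (star (inv x)); lra.
Qed.

Lemma value_star x : f (star x) = Num.max 0 (2 * f x - 1).
Proof.
case: (boolP (upper x)) => xu.
  have := fE x; rewrite xu => fx.
  by have := value_ge0 (star x); rewrite maxElt; case: ifP => ?; lra.
have := value_lower xu.
move: xu; rewrite upperN -(star_eq0 A_nontrivial) => /eqP ->.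
by rewrite value0 maxElt; case: ifP => ?; lra.
Qed.

(** The two instances of the recursion, at x and at inv x, refer to the same
further value; at the midpoint that value is f \bot. *)
Lemma value_inv x : f (inv x) = 1 - f x.
Proof.
have [/eqP sx|/negbTE xs] := boolP (x == inv x).
  have xl : star x = \bot by apply/eqP; rewrite (star_eq0 A_nontrivial) -sx.
  by rewrite -sx fE /upper -!sx ltxx xl value0; lra.
have := fE x; have := fE (inv x); rewrite /upper invK.
by case: ltgtP xs => //; lra.
Qed.

(** The value 1 is passed on along the whole orbit and is taken in the upper
half only. *)
Lemma value_eq1 x : f x = 1 -> x = \top.
Proof.
move=> fx; apply: (always_upper A_nontrivial) => i.
suff fi : f (iter i step x) = 1.
  by apply/negPn/negP => /value_lower; rewrite fi; lra.
elim: i => //= i IH; rewrite /step; case: ifPn => [u|/value_lower]; last first.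
  by rewrite IH; lra.
by rewrite value_star IH maxElt; case: ifP; lra.
Qed.

Lemma value_upper x : upper x -> 2^-1 < f x.
Proof.
move=> xu; have : f (star x) != 0.
  apply/eqP => fs; have /value_eq1 : f (inv (star x)) = 1.
    by rewrite value_inv fs subr0.
  by move/eqP; rewrite inv_eq1 (star_eq0 A_nontrivial) -upperN xu.
by rewrite [f x]fE xu neq_lt ltNge value_ge0 /=; lra.
Qed.

(** At the time of separation the values lie on both sides of 1/2. Before it,
both points follow the same branch: star is increasing on the upper half and so
is 2 f - 1; inv is decreasing and so is 1 - f. *)
Lemma value_lt_separated i x y :
  upper (iter i step x) != upper (iter i step y) -> (x < y)%O -> f x < f y.
Proof.
have base u v : upper u != upper v -> (u < v)%O -> f u < f v.
  move=> neq_uv uv; have [vu|vl] := boolP (upper v).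
    have ul : ~~ upper u by move: neq_uv; rewrite vu; case: (upper u).
    exact: le_lt_trans (value_lower ul) (value_upper vu).
  have uu : upper u by move: neq_uv; rewrite (negbTE vl); case: (upper u).
  by rewrite (upper_le A_nontrivial (ltW uv) uu) in vl.
elim: i x y => [|i IH] x y sep xy; first exact: base.
have [eq_u|] := eqVneq (upper x) (upper y); last by move/base; apply.
rewrite !iterSr in sep.
have := IH _ _ sep; rewrite eq_sym in sep; have := IH _ _ sep.
rewrite /step -eq_u; case: ifP => [xu _|xl].
  have yu : upper y by rewrite -eq_u.
  move=> /(_ (star_mono A_nontrivial (ltW xu) (ltW yu) xy)).
  by have := fE x; have := fE y; rewrite xu yu; lra.
by rewrite (lt_inv A_nontrivial) !value_inv => /(_ xy); lra.
Qed.
End Value.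

Lemma representable_of_same_itinerary_eq :
  (forall x y, same_itinerary x y -> x = y) -> representable R A.
Proof.
move=> itin_eq; have [f fE] := value_exists.
have f01 x : 0 <= f x <= 1 by rewrite value_ge0 // value_le1.
have f_lt x y : (x < y)%O -> f x < f y.
  move=> xy.
  have [i sep] : exists i, upper (iter i step x) != upper (iter i step y).
    have /boolp.existsNP[i /eqP] : ~ same_itinerary x y.
      by move/itin_eq/eqP; rewrite lt_eqF.
    by exists i.
  exact: (value_lt_separated fE sep).
have f_le x y : (x <= y)%O -> f x <= f y.
  by rewrite le_eqVlt => /orP[/eqP ->|/f_lt/ltW].
exists (fun x => exist _ (f x) (f01 x)); split.
  by move=> x y [eq_f]; apply/eqP; case: ltgtP => // /f_lt; rewrite eq_f ltxx.
split=> [x y|x|x||]; apply: val_inj => /=.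
- case: (leP x y) => [xy|/ltW xy]; have := f_le _ _ xy => fxy.
    by rewrite max_r.
  by rewrite max_l.
- exact: value_star.
- exact: value_inv.
- exact: value0.
- exact: value1.
Qed.

(** * Uniqueness of fixed points in a representable chain *)

Definition inner x := (x != \bot) && (x != \top).

Lemma star0 : star (\bot : A) = \bot.
Proof. by apply/eqP; rewrite (star_eq0 A_nontrivial) le0x. Qed.

(** Both operations map the set of \bot and \top to itself. *)
Lemma sk_eval_inner s x : inner (sk_eval s x) -> inner x.
Proof.
elim: s x => // o s IH x /IH; case: o => /=; rewrite /inner.
  case: eqVneq => //= sx0; case: eqVneq => //= sx1 _.
  apply/andP; split; apply/eqP => x_eq.
    by rewrite x_eq star0 eqxx in sx0.
  by rewrite x_eq (star_top A_nontrivial) eqxx in sx1.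
by rewrite inv_eq1 -inv1 (inj_eq inv_inj) andbC.
Qed.

Definition is_star o := if o is SkStar then true else false.

Lemma sk_repeat_comm j s : sk_repeat j s ++ s = s ++ sk_repeat j s.
Proof. by elim: j => [|j IH]; rewrite /sk_repeat /= ?cats0 // -catA IH. Qed.

Section Embedding.
Variable f : A -> R.
Hypothesis f_inj : injective f.
Hypothesis f_star : forall x, f (star x) = Num.max 0 (2 * f x - 1).
Hypothesis f_inv : forall x, f (inv x) = 1 - f x.
Hypothesis f_bot : f \bot = 0.

Lemma f_star_affine x : star x != \bot -> f (star x) = 2 * f x - 1.
Proof.
rewrite -(inj_eq f_inj) f_bot f_star maxElt; case: ifP => //.
by rewrite eqxx.
Qed.

(** No star in the sequence may hit the constant branch of 2 f - 1 truncated at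
0, since the final values are not extremal; each star thus acts by an affine
map of slope 2, and each inv by one of slope -1. *)
Lemma sk_eval_expand s x y : inner (sk_eval s x) -> inner (sk_eval s y) ->
  `|f (sk_eval s x) - f (sk_eval s y)| = 2 ^+ count is_star s * `|f x - f y|.
Proof.
elim: s x y => [|o s IH] x y; first by rewrite mul1r.
move=> sx sy; rewrite [LHS](IH _ _ sx sy).
have /andP[x0 _] := @sk_eval_inner s (sk_apply o x) sx.
have /andP[y0 _] := @sk_eval_inner s (sk_apply o y) sy.
case: o {sx sy} x0 y0 => /= x0 y0.
  rewrite (f_star_affine x0) (f_star_affine y0) exprS.
  have -> : 2 * f x - 1 - (2 * f y - 1) = 2 * (f x - f y) by lra.
  by rewrite normrM [`|2|]ger0_norm // mulrA [2 * _]mulrC.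
rewrite !f_inv add0n; have -> : 1 - f x - (1 - f y) = - (f x - f y) by lra.
by rewrite normrN.
Qed.

Lemma sk_fixpoint_unique s x y : has is_star s -> inner x -> inner y ->
  sk_eval s x = x -> sk_eval s y = y -> x = y.
Proof.
rewrite has_count => s_star x_in y_in sx sy.
have := @sk_eval_expand s x y; rewrite sx sy => /(_ x_in y_in) /eqP.
rewrite -[X in X == _]mul1r -subr_eq0 -mulrBl mulf_eq0 normr_eq0 !subr_eq0.
case/orP => [|/eqP/f_inj//]; rewrite lt_eqF // exprn_egt1 ?ltr1n //.
by rewrite -lt0n.
Qed.

(** For (R1): if s maps x to y and its (r-1)-fold repetition maps y back to x,
then x and y are both fixed by the r-fold repetition of s, so they are equal.
*)
Lemma sk_sat s r : has is_star s -> sat_R1 A s r /\ sat_R2 A s.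
Proof.
move=> s_star; split.
  apply/(sat_R1P A_nontrivial) => x x0 x1 sx; apply/eqP => rx.
  have x_in : inner x by rewrite /inner x0.
  have y_in : inner (sk_eval s x).
    by apply: (@sk_eval_inner (sk_repeat r.-1 s)); rewrite rx.
  case/eqP: sx; apply: (@sk_fixpoint_unique (s ++ sk_repeat r.-1 s)) => //.
  - by rewrite has_cat s_star.
  - by rewrite -sk_repeat_comm sk_eval_cat rx.
  - by rewrite sk_eval_cat.
apply/(sat_R2P A_nontrivial) => x y x0 x1 y0 y1.
by apply: sk_fixpoint_unique; rewrite // /inner ?x0 ?y0.
Qed.
End Embedding.

Lemma sk_sat_of_representable s r :
  representable R A -> has is_star s -> sat_R1 A s r /\ sat_R2 A s.
Proof.
move=> [F [F_inj [_ Fstar Finv F0 _]]].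
apply: (@sk_sat (fun x => sval (F x))).
- by move=> x y /val_inj/F_inj.
- by move=> x; rewrite (Fstar x).
- by move=> x; rewrite (Finv x).
- by rewrite F0.
Qed.
End Representation.

Lemma is_sk_star s : is_sk s -> has is_star s.
Proof. by case=> -[|[|m] ns] [nm [//= _ m_gt0 ->]]. Qed.

Theorem theorem5p17 (R : realType) (n : nat) (d : Order.disp_t)
    (A : finIGStarChainType d)
    (A_nontrivial : (\bot : A)%O <> (\top : A)%O)
    (A_variety : in_variety_generated_by 'I_n.+1 A) :
  representable R A <->
  (forall s : seq sk_symbol, is_sk s ->
   forall r : nat, (1 <= r)%N -> (r * size s <= n + 1)%N ->
     sat_R1 A s r /\ sat_R2 A s).
Proof.
split=> [repA s /is_sk_star s_star r _ _|A_sat].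
  exact: (sk_sat_of_representable A_nontrivial r repA s_star).
apply: (representable_of_same_itinerary_eq R A_nontrivial) => x y.
exact: (same_itinerary_eq A_nontrivial (variety_card A_nontrivial A_variety)).
Qed.
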